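(* For every positive integer $k$, $\mathrm{mader}_{\delta^+}^{(k)}(C(k,k))\geq 3$; that is, there exists a digraph $D$ with minimum out-degree $\delta^+(D)\geq 2$ and girth $g(D)\geq k$ that contains no subdivision of $C(k,k)$.
   Context: $\delta^+(D)$ denotes the minimum out-degree of a digraph $D$. A (directed) path/cycle is one in which all arcs are oriented consistently. The girth $g(D)$ is the length of a shortest directed cycle of $D$, with $g(D)=+\infty$ if $D$ has no directed cycle. For positive integers $k,\ell$, $C(k,\ell)$ denotes the digraph formed by two internally vertex-disjoint directed paths of lengths $k$ and $\ell$ having the same initial vertex and the same terminal vertex. For a digraph $F$, a subdivision of $F$ is a digraph obtained from $F$ by replacing each arc $xy$ by a directed path from $x$ to $y$, these paths being pairwise internally vertex-disjoint. For an integer $g$ and a digraph $F$, $\mathrm{mader}_{\delta^+}^{(g)}(F)$ denotes the least integer $m$ such that every digraph $D$ with $\delta^+(D)\geq m$ and $g(D)\geq g$ contains a subdivision of $F$ as a subdigraph. *)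

(* Defs.v *)
From HB Require Import structures.
From mathcomp Require Import all_boot.
From mathcomp Require Import boolp.

Set Implicit Arguments.
Unset Strict Implicit.
Unset Printing Implicit Defensive.

(* Values in nat extended with +oo: None stands for +oo. *)
Definition enat := option nat.

Definition leq_enat (n : nat) (x : enat) : bool :=
  if x is Some m then n <= m else true.

(* Minimum of a set of naturals, +oo if the set is empty. *)
Definition least (P : nat -> Prop) : enat :=
  match pselect (exists n, `[< P n >]) with
  | left exP => Some (ex_minn exP)
  | right _ => None
  end.

(* Finite digraphs without parallel arcs. Opposite arcs are allowed; so are
   loops, a loop being a directed cycle of length 1. Hence girth >= 2 already
   means that there is no loop. *)
Record digraph := Digraph {
  vertex :> finType;
  arc : rel vertex
}.

(* Digraphs with possibly parallel arcs: C(1,1) consists of two parallel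
   arcs, so the digraphs to be subdivided are taken in this class. *)
Record multidigraph := Multidigraph {
  mvertex : finType;
  marc : finType;
  tail : marc -> mvertex;
  head : marc -> mvertex
}.

Definition outdeg (D : digraph) (v : D) : nat := #|[set w | arc v w]|.

(* The default value #|D| is neutral since it bounds every out-degree. *)
Definition min_outdeg (D : digraph) : nat :=
  \big[minn/#|D|]_(v : D) outdeg v.

Definition has_dicycle (D : digraph) (n : nat) : Prop :=
  exists c : seq D, [/\ 0 < n, size c = n & ucycle (@arc D) c].

Definition girth (D : digraph) : enat := least (has_dicycle D).

(* H is obtained from F by replacing each arc a by a directed path from
   phi (tail a) to phi (head a) with sequence of internal vertices s a (so of
   length (size (s a)).+1). Injectivity of the triples says that parallel arcs
   are replaced by distinct paths, which internal disjointness alone does not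
   give for paths of length 1. The last two clauses say that H has no other
   vertices or arcs. *)
Definition is_subdivision (F : multidigraph) (H : digraph) : Prop :=
  exists (phi : mvertex F -> H) (s : marc F -> seq H),
    let walk a := phi (tail a) :: rcons (s a) (phi (head a)) in
    [/\ injective phi,
        forall a, path (@arc H) (phi (tail a)) (rcons (s a) (phi (head a))) &
        forall a, uniq (s a)] /\
    [/\ forall a x, phi x \notin s a,
        forall a b, a != b -> ~~ has (mem (s a)) (s b) &
        injective (fun a => (tail a, s a, head a))] /\
    [/\ forall v : H, (exists x, v = phi x) \/ (exists a, v \in s a) &
        forall u v : H, arc u v ->
          exists a, (u, v) \in zip (walk a) (behead (walk a))].

Definition subdigraph (H D : digraph) : Prop :=
  exists f : H -> D,
    injective f /\ forall u v : H, arc u v -> arc (f u) (f v).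

Definition contains_subdivision (F : multidigraph) (D : digraph) : Prop :=
  exists H : digraph, is_subdivision F H /\ subdigraph H D.

(* C(k,l), for k, l > 0, on the k + l vertices 0, ..., k + l - 1. The first
   path is 0, 1, ..., k and the second one 0, k + 1, ..., k + l - 1, k. *)
Definition second_path (k l j : nat) : nat :=
  if j == 0 then 0 else if j == l then k else k + j.

Definition C (k l : nat) : multidigraph :=
  @Multidigraph 'I_(k + l).-1.+1 ('I_k + 'I_l)%type
    (fun a => match a with
              | inl i => inord i
              | inr j => inord (second_path k l j)
              end)
    (fun a => match a with
              | inl i => inord i.+1
              | inr j => inord (second_path k l j.+1)
              end).

Definition forces_subdivision (g : nat) (F : multidigraph) (m : nat) : Prop :=
  forall D : digraph, 0 < #|D| ->
    m <= min_outdeg D -> leq_enat g (girth D) -> contains_subdivision F D.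

Definition mader (g : nat) (F : multidigraph) : enat :=
  least (forces_subdivision g F).

(* Main.v *)
From mathcomp Require Import all_boot.
From mathcomp Require Import boolp zify.
Require Import Defs.

Set Implicit Arguments.
Unset Strict Implicit.
Unset Printing Implicit Defensive.

(** For [k >= 2] take the circulant digraph on the integers modulo [2k - 1]
    with steps [1] and [2].  A directed cycle of length [L] winds around at
    least once, so [2k - 1 <= 2L] and the girth is at least [k]; and there are
    fewer than the [2k] vertices that a subdivision of [C(k,k)] needs.
    For [k = 1] this circulant has out-degree only [1]; there two vertices with
    all four arcs, loops included, work: subdividing [C(1,1)] would take two
    different paths between the two vertices, but there is only one. *)

Lemma leq_least (n : nat) (P : nat -> Prop) :
  (forall m, P m -> n <= m) -> leq_enat n (least P).
Proof.
move=> lb; rewrite /least; case: pselect => //= exP.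
by case: ex_minnP => m /asboolP /lb.
Qed.

Lemma leq_min_outdeg (D : digraph) (m : nat) :
  m <= #|D| -> (forall v : D, m <= outdeg v) -> m <= min_outdeg D.
Proof.
move=> mD mdeg; rewrite /min_outdeg; elim/big_ind: _ => // x y mx my.
by rewrite leq_min mx.
Qed.

Lemma outdeg_gt1 (D : digraph) (v a b : D) :
  a != b -> arc v a -> arc v b -> 1 < outdeg v.
Proof.
move=> neq_ab va vb; have <- : #|[set a; b]| = 2 by rewrite cards2 neq_ab.
by apply/subset_leq_card/subsetP=> w; rewrite !inE => /orP[] /eqP->.
Qed.

(** Such a [D] refutes every threshold [n <= m] at once, since its out-degrees also meet the smaller
    bound. *)
Lemma leq_mader (g m : nat) (F : multidigraph) (D : digraph) :
  0 < #|D| -> m <= min_outdeg D -> leq_enat g (girth D) ->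
  ~ contains_subdivision F D -> leq_enat m.+1 (mader g F).
Proof.
move=> D0 mD gD nF; apply: leq_least => n forces_n; rewrite ltnNge.
by apply/negP => n_m; apply/nF/forces_n => //; apply: leq_trans n_m mD.
Qed.

Lemma contains_subdivision_card (F : multidigraph) (D : digraph) :
  contains_subdivision F D -> #|mvertex F| <= #|D|.
Proof.
move=> [H [[phi [s [[phi_inj _ _] _]]] [f [f_inj _]]]].
exact: leq_trans (leq_card _ phi_inj) (leq_card _ f_inj).
Qed.

Definition circulant_arc (n : nat) : rel 'I_n :=
  [rel u v : 'I_n | (val v == u.+1 %% n) || (val v == u.+2 %% n)].

Definition circulant (n : nat) : digraph := Digraph (@circulant_arc n).

(** Here [t] is the total displacement of the walk before reduction modulo [n]: each arc adds 1 or
    2. *)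
Lemma circulant_walk (n : nat) (x : circulant n) (p : seq (circulant n)) :
  path (@arc _) x p ->
  exists2 t, size p <= t <= (size p).*2
           & val (last x p) = x + t %[mod n].
Proof.
elim: p x => [|y p IHp] x /=; first by exists 0; rewrite ?addn0.
case/andP=> xy /IHp [t t_bounds ->]; move: (size p) t_bounds => L t_bounds.
case/orP: xy => /eqP/= y_def.
  exists t.+1; first by lia.
  by rewrite y_def modnDml addSnnS.
exists t.+2; first by lia.
by rewrite y_def modnDml !addSnnS.
Qed.

Lemma circulant_girth (n k : nat) :
  k.*2 <= n.+1 -> leq_enat k (girth (circulant n)).
Proof.
move=> k_n; apply: leq_least => L [[|x p] [L_gt0 L_def /andP[cyc _]]].
  by rewrite -L_def in L_gt0.
have [t] := circulant_walk cyc.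
rewrite last_rcons size_rcons [(size p).+1]L_def => t_bounds /eqP.
(* The walk ends where it began, so cancelling [x] leaves [n] dividing [t]; as [t >= L > 0], this
   gives [n <= t <= 2L]. *)
rewrite -[X in X == _ %[mod _]]addn0 eqn_modDl eq_sym mod0n => n_t.
have : n <= t by apply: dvdn_leq => //; lia.
by lia.
Qed.

Lemma circulant_min_outdeg (n : nat) : 2 < n -> 2 <= min_outdeg (circulant n).
Proof.
move=> n_gt2; have n_gt0 : 0 < n by lia.
apply: leq_min_outdeg => [|v]; first by rewrite card_ord; lia.
pose step i : circulant n := Ordinal (ltn_pmod i n_gt0).
apply: (@outdeg_gt1 _ v (step v.+1) (step v.+2)); rewrite /= /circulant_arc /= ?eqxx ?orbT //.
(* Cancelling [v] reduces the claim to 1 and 2 being distinct modulo [n > 2]. *)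
rewrite -val_eqE /= -[v.+2]addn2 -[v.+1]addn1 eqn_modDl.
by rewrite !modn_small //; lia.
Qed.

Definition looped_K2 : digraph := @Digraph bool (fun _ _ => true).

Lemma looped_K2_no_C11 : ~ contains_subdivision (C 1 1) looped_K2.
Proof.
move=> [H [[phi [s [[phi_inj _ _] [[phi_s _ s_inj] _]]]] [f [f_inj _]]]].
have H_card : #|H| <= #|mvertex (C 1 1)|.
  by apply: leq_trans (leq_card _ f_inj) _; rewrite card_bool card_ord.
(* The two branch vertices exhaust [H], so no vertex is left to be internal. *)
have s_nil a : s a = [::].
  case s_def: (s a) => [|y t] //.
  have /codomP [x y_def] := inj_card_onto phi_inj H_card y.
  by have := phi_s a x; rewrite s_def -y_def mem_head.
(* Both arcs run from 0 to 1, so with empty interiors their triples coincide. *)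
have := s_inj (inl ord0) (inr ord0).
by rewrite !s_nil => /(_ erefl).
Qed.

Lemma exists_digraph_without_Ckk (k : nat) : 0 < k ->
  exists D : digraph,
    [/\ 2 <= min_outdeg D,
        leq_enat k (girth D) &
        ~ contains_subdivision (C k k) D].
Proof.
case: k => [|[|k]] // _.
  exists looped_K2; split; last exact: looped_K2_no_C11.
    apply: leq_min_outdeg => [|v]; first by rewrite card_bool.
    exact: (@outdeg_gt1 _ v true false).
  by apply: leq_least => n [c []].
(* The original parameter is now [k.+2], and [2(k + 2) - 1 = 2k + 3]. *)
exists (circulant k.*2.+3); split.
- exact: circulant_min_outdeg.
- by apply: circulant_girth; lia.
- by move/contains_subdivision_card; rewrite !card_ord; lia.
Qed.

Theorem theorem1p3 (k : nat) (hk : 0 < k) :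
  leq_enat 3 (mader k (C k k)) /\
  exists D : digraph,
    [/\ 2 <= min_outdeg D,
        leq_enat k (girth D) &
        ~ contains_subdivision (C k k) D].
Proof.
have [D [deg_D girth_D noC]] := exists_digraph_without_Ckk hk.
split; last by exists D.
apply: (leq_mader _ deg_D girth_D noC).
(* On an empty digraph the minimum takes its default value [#|D| = 0], against [deg_D]. *)
rewrite lt0n; apply: contraTneq deg_D => D0.
rewrite /min_outdeg big_pred0 ?D0 // => v.
by have := fintype0 v D0.
Qed.
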